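(* Let $T$ be a nonabelian finite simple group. Then the co-intersection graph $\Delta_T^c$ is connected and $\operatorname{diam}(\Delta_T^c) = 2$.
   Context: For a group $G$, the co-intersection graph $\Delta_G^c$ is the simple graph whose vertices are the nontrivial proper subgroups of $G$, two distinct subgroups being adjacent if and only if they intersect trivially. For a finite connected graph $\Gamma$, the diameter $\operatorname{diam}(\Gamma)$ is the greatest path-distance occurring between pairs of vertices of $\Gamma$. *)

(* Defs.v *)
From HB Require Import structures.
From mathcomp Require Import all_boot all_fingroup all_solvable.

Set Implicit Arguments.
Unset Strict Implicit.
Unset Printing Implicit Defensive.

Import GroupScope.

Section Graph.

Variables (V : finType) (e : rel V).

Definition gconnected : Prop :=
  0 < #|V| /\ forall x y : V, connect e x y.

Definition walk (n : nat) (x y : V) : bool :=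
  [exists p : n.-tuple V, path e x p && (last x p == y)].

(* Length of a shortest walk from x to y. It is enough to search lengths
   below #|V|; the value is the junk value #|V| when y is unreachable. *)
Definition gdist (x y : V) : nat :=
  find (fun n => walk n x y) (iota 0 #|V|).

Definition diam : nat := \max_(x : V) \max_(y : V) gdist x y.

Lemma walkP n x y :
  reflect (exists p : seq V, [/\ size p = n, path e x p & last x p = y])
          (walk n x y).
Proof.
apply: (iffP existsP) => [[p /andP[xp /eqP lp]] | [p [sp xp lp]]].
  by exists p; rewrite size_tuple.
have sp' : size p == n by apply/eqP.
by exists (Tuple sp'); rewrite /= xp lp eqxx.
Qed.

Lemma connect_walk x y : connect e x y -> exists2 n, n < #|V| & walk n x y.
Proof.
case/connectP=> p xp ->; case/shortenP: xp => q xq uq _.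
exists (size q); last by apply/walkP; exists q.
by rewrite -[(size q).+1]/(size (x :: q)) -(card_uniqP uq) max_card.
Qed.

Lemma walk_gdist x y : connect e x y -> walk (gdist x y) x y.
Proof.
case/connect_walk=> n ltn wn.
have hw : has (fun n => walk n x y) (iota 0 #|V|).
  by apply/hasP; exists n; rewrite // mem_iota.
have := nth_find 0 hw; rewrite nth_iota ?add0n //.
by move: hw; rewrite has_find size_iota.
Qed.

Lemma gdist_min n x y : walk n x y -> gdist x y <= n.
Proof.
move=> wn; rewrite leqNgt; apply/negP => lt.
have := before_find 0 lt; rewrite nth_iota ?add0n ?wn //.
by apply: leq_trans lt _; rewrite -[X in _ <= X](size_iota 0) find_size.
Qed.

End Graph.

Section CoIntersection.

Variables (gT : finGroupType) (G : {group gT}).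

Definition cointV : finType :=
  {H : {group gT} | (H :!=: 1) && (H \proper G)}.

Definition coint : rel cointV :=
  [rel H K : cointV | (H != K) && (val H :&: val K == 1)].

Lemma coint_sym : symmetric coint.
Proof. by move=> H K; rewrite /coint /= eq_sym setIC. Qed.

Lemma coint_irr : irreflexive coint.
Proof. by move=> H; rewrite /coint /= eqxx. Qed.

End CoIntersection.

Arguments coint {gT} G.

(* Main.v *)
(* Bound: if a T-invariant generating set A of the simple group T were covered
   by two proper subgroups H and K, then A :\: K, which lies in H, would be
   normalised by K and by itself, hence would generate a normal subgroup of T.
   So some element x of prime order lies outside H and K, and <[x]> is a common
   neighbour of H and K.
   Distance two is attained: otherwise distinct nontrivial proper subgroups
   always meet trivially, so each is a self-normalising TI-subgroup whose
   conjugates cover at least half of T; two non-conjugate ones do not fit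
   in T^#. *)
Require Import Defs.
From HB Require Import structures.
From mathcomp Require Import all_boot all_fingroup all_solvable.

Set Implicit Arguments.
Unset Strict Implicit.
Unset Printing Implicit Defensive.

Import GroupScope.

Lemma simple_gen_class_closed (gT : finGroupType) (T : {group gT})
    (A : {set gT}) :
    simple T -> A \subset T -> T \subset 'N(A) -> ~~ (A \subset [1 gT]) ->
  <<A>> = T.
Proof.
move=> /simpleP[_ simT] sAT nAT; case: (simT <<A>>%G) => //=.
  by rewrite /normal gen_subG sAT norms_gen.
by move=> A1; rewrite -A1 subset_gen.
Qed.

Lemma simple_class_closed_not_cover (gT : finGroupType) (T H K : {group gT})
    (A : {set gT}) :
    simple T -> A \subset T -> T \subset 'N(A) -> ~~ (A \subset [1 gT]) ->
    H \proper T -> K \proper T ->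
  ~~ (A \subset H :|: K).
Proof.
move=> simT sAT nAT ntA prH prK; apply/negP=> sAHK.
have genA := simple_gen_class_closed simT sAT nAT ntA.
have sKT := proper_sub prK.
have ncover (L : {group gT}) : L \proper T -> ~~ (A \subset L).
  by move=> prL; rewrite -gen_subG genA proper_subn.
have sBH : A :\: K \subset H by rewrite subDset setUC.
have sBT : A :\: K \subset T by rewrite (subset_trans (subsetDl _ _)).
have nBK : K \subset 'N(A :\: K) by rewrite normsD ?normG ?(subset_trans sKT).
(* As [A] generates [T], it is enough that both pieces of [A] normalise: [A :&: K] does because [K]
   normalises [A] and itself, and [A :\: K] does because it lies in the subgroup. *)
have nBT : T \subset 'N(<<A :\: K>>).
  rewrite -{1}genA gen_subG -{1}(setID A K) subUset.
  rewrite (subset_trans (subsetIr A K) (norms_gen nBK)) /=.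
  exact: subset_trans (subset_gen _) (normG _).
have [_ /(_ <<A :\: K>>%G)[|genB|genB]] := simpleP _ simT.
- by rewrite /normal gen_subG sBT.
(* Since [K] contains 1, a trivial [<<A :\: K>>] forces [A :\: K] to be empty, so [A] would lie in
   [K]. *)
- have /negP[] := ncover K prK.
  rewrite -setD_eq0; apply/eqP/setP=> x; rewrite [RHS]inE.
  apply/negP=> Bx; have /setDP[_ /negP[]] := Bx.
  by have /set1P-> : x \in [1 gT] by rewrite -genB mem_gen.
by have := proper_subn prH; rewrite -{1}genB gen_subG sBH.
Qed.

(** The elements of order [p], for one prime [p] dividing [#|T|], form a conjugation-invariant set,
    nontrivial by Cauchy, to which the covering obstruction applies. *)
Lemma simple_prime_order_avoid (gT : finGroupType) (T H K : {group gT}) :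
    simple T -> H \proper T -> K \proper T ->
  exists x, [/\ x \in T, prime #[x], x \notin H & x \notin K].
Proof.
move=> simT prH prK; have [ntT _] := simpleP _ simT.
have p_pr : prime (pdiv #|T|) by rewrite pdiv_prime ?cardG_gt1.
set p := pdiv _ in p_pr; pose A := [set x in T | #[x] == p].
have [y Ty oy] := Cauchy p_pr (pdiv_dvd #|T|).
have sAT : A \subset T by apply/subsetP=> x; rewrite inE => /andP[].
have nAT : T \subset 'N(A).
  apply/subsetP=> g Tg; rewrite inE; apply/subsetP=> _ /imsetP[x Ax ->].
  by move: Ax; rewrite !inE orderJ => /andP[Tx ->]; rewrite groupJ.
have ntA : ~~ (A \subset [1 gT]).
  apply/subsetPn; exists y; first by rewrite inE Ty oy eqxx.
  by rewrite inE -order_gt1 oy prime_gt1.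
have /subsetPn[x] := simple_class_closed_not_cover simT sAT nAT ntA prH prK.
by rewrite !inE negb_or => /andP[Tx /eqP ox] /andP[nHx nKx]; exists x; rewrite ox.
Qed.

Lemma cycle_proper_nonabelian (gT : finGroupType) (T : {group gT}) x :
  ~~ abelian T -> x \in T -> <[x]> \proper T.
Proof.
move=> nabT Tx; rewrite properEneq cycle_subG Tx andbT.
by apply: contraNneq nabT => <-; apply: cycle_abelian.
Qed.

(** By simplicity [H] is not normal, so ['N_T(H)] is a proper subgroup containing [H] and must equal
    [H]. A conjugate [H :^ g] meeting [H] nontrivially also equals [H], which puts [g] in
    ['N_T(H) = H]. *)
Lemma simple_TI_normedTI (gT : finGroupType) (T H : {group gT}) :
    simple T -> H :!=: 1 -> H \proper T ->
    (forall K : {group gT}, K :!=: 1 -> K \proper T -> H :&: K != 1 ->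
       H :=: K) ->
  normedTI H^# T H.
Proof.
move=> simT ntH prH tiH; have sHT := proper_sub prH.
have [_ normalT] := simpleP _ simT.
have sHN : H \subset 'N_T(H) by rewrite subsetI sHT normG.
have defN : 'N_T(H) = H.
  symmetry; apply: (tiH 'N_T(H)%G).
  - by apply: contraNneq ntH => /= N1; rewrite -subG1 -N1.
  - rewrite properEneq subsetIl andbT; apply/eqP=> /= /setIidPl nHT.
    have [||] := normalT H; rewrite /normal ?sHT //; first exact/eqP.
    by move/eqP; rewrite eqEproper prH andbF.
  - by rewrite (setIidPl sHN).
apply/normedTI_P; split; first by rewrite setD_eq0 subG1.
  by rewrite subsetI sHT normD1 normG.
move=> g Tg /pred0Pn[x /andP[/= /setD1P[ntx Hx]]].
rewrite conjD1g => /setD1P[_ Hgx].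
rewrite -defN inE Tg /= inE; suff -> : H :^ g = H by [].
symmetry; apply: (tiH (H :^ g)%G) => /=.
- by rewrite -(conjs1g g) (inj_eq (@conjsg_inj _ g)).
- by rewrite -(conjGid Tg) properJ.
- by apply/trivgPn; exists x; rewrite // inE Hx.
Qed.

(* As |H| >= 2, the conjugates of H cover (|H| - 1) |G| / |H| >= |G| / 2
   nontrivial elements. *)
Lemma card_support_half (gT : finGroupType) (G H : {group gT}) :
    H :!=: 1 -> H \subset G -> normedTI H^# G H ->
  #|G| <= (#|class_support H^# G|).*2.
Proof.
move=> ntH sHG tiH; rewrite (card_support_normedTI tiH) -(Lagrange sHG).
rewrite doubleMl leq_mul2r; apply/orP; right.
have : 1 < #|H| by rewrite cardG_gt1.
by rewrite (cardsD1 1 H) group1 add1n ltnS => H0; rewrite -addnn -add1n leq_add2r.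
Qed.

Lemma simple_nonabelian_meet (gT : finGroupType) (T : {group gT}) :
    simple T -> ~~ abelian T ->
  exists H K : {group gT},
    [/\ (H :!=: 1) && (H \proper T), (K :!=: 1) && (K \proper T),
        H != K & H :&: K != 1].
Proof.
move=> simT nabT; have [ntT _] := simpleP _ simT.
pose V := [pred H : {group gT} | (H :!=: 1) && (H \proper T)].
case: (boolP [exists H in V, exists K in V, (H != K) && (H :&: K != 1)]).
  case/exists_inP=> H VH /exists_inP[K VK /andP[neHK ntHK]].
  by exists H, K; split.
move=> tiV; exfalso.
have tiT (H K : {group gT}) : H \in V -> K \in V -> H :&: K != 1 -> H :=: K.
  move=> VH VK ntHK; apply/eqP; apply: contraNT tiV => neHK.
  by apply/exists_inP; exists H => //; apply/exists_inP; exists K => //; apply/andP.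
have tiN (H : {group gT}) : H \in V -> normedTI H^# T H.
  move=> VH; have /andP[ntH prH] := VH.
  apply: simple_TI_normedTI => // K ntK prK.
  by apply: tiT; rewrite // inE ntK.
have cycV x : x \in T^# -> <[x]>%G \in V.
  by case/setD1P=> ntx Tx; rewrite inE /= cycle_eq1 ntx cycle_proper_nonabelian.
have supS (H : {group gT}) : H \in V -> class_support H^# T \subset T^#.
  case/andP=> _ /proper_sub sHT.
  apply/subsetP=> _ /imset2P[a g /setD1P[nta Ha] Tg ->].
  by rewrite !inE conjg_eq1 nta groupJ // (subsetP sHT).
have supcard (H : {group gT}) : H \in V -> #|T| <= (#|class_support H^# T|).*2.
  by move=> VH; have /andP[ntH /proper_sub sHT] := VH; apply: card_support_half (tiN H VH).
have [x Tx ntx] := trivgPn _ ntT.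
have T1x : x \in T^# by rewrite !inE ntx.
have Vx := cycV x T1x; set H := <[x]>%G in Vx.
have /andP[ntH prH] := Vx; have sHT := proper_sub prH.
(* The conjugates of [H] cover [#|T| - #|T : H|] nontrivial elements, fewer than [#|T| - 1] because
   [H] is proper. So some [y] is missed. *)
have /subsetPn[y T1y nHy] : ~~ (T^# \subset class_support H^# T).
  apply/negP=> /subset_leq_card; rewrite (card_support_normedTI (tiN H Vx)).
  rewrite -(leq_add2l #|T : H|) -mulSn -add1n.
  have -> : (1 + #|H^#| = #|H|)%N by rewrite (cardsD1 1 H) group1.
  rewrite Lagrange // (cardsD1 1 T) group1 leq_add2r leqNgt.
  by rewrite indexg_gt1 proper_subn.
have Vy := cycV y T1y; set K := <[y]>%G in Vy.
(* If [a ^ g = b ^ h], then [b] lies in both [H :^ k] and [K], so these coincide and [y] falls in a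
   conjugate of [H], against its choice. *)
have disj : [disjoint class_support H^# T & class_support K^# T].
  apply/pred0P=> z /=; apply/negP=> /andP[].
  case/imset2P=> a g /setD1P[nta Ha] Tg ->.
  case/imset2P=> b h /setD1P[ntb Kb] Th def_ab.
  pose k := g * h^-1; have Tk : k \in T by rewrite groupM ?groupV.
  have VHk : (H :^ k)%G \in V.
    rewrite inE /= -(conjs1g k) (inj_eq (@conjsg_inj _ k)) ntH /=.
    by rewrite -(conjGid Tk) properJ.
  have defK : H :^ k = K.
    apply: (tiT (H :^ k)%G K VHk Vy); apply/trivgPn; exists b => //.
    rewrite inE Kb andbT -(conjgK h b) -def_ab -conjgM.
    by rewrite memJ_conjg.
  case/negP: nHy; have Ky : y \in H :^ k by rewrite defK cycle_id.
  have /setD1P[nty _] := T1y.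
  case/imsetP: Ky => c Hc def_y; apply/imset2P; exists c k => //.
  by rewrite !inE Hc andbT; apply: contraNneq nty => c1; rewrite def_y c1 conj1g.
have leU : #|class_support H^# T| + #|class_support K^# T| <= #|T^#|.
  rewrite -cardsUI (_ : _ :&: _ = set0) ?cards0 ?addn0.
    by rewrite subset_leq_card // subUset !supS.
  by apply/eqP; rewrite setI_eq0.
(* Two disjoint sets of size at least [#|T| / 2] would fit in [T^#], which has only [#|T| - 1]
   elements. *)
have := leq_add (supcard H Vx) (supcard K Vy).
rewrite addnn -doubleD leq_double => /leq_trans/(_ leU).
by rewrite (cardsD1 1 T) group1 ltnn.
Qed.

Theorem theorem1p1 (gT : finGroupType) (T : {group gT})
    (simpleT : simple T) (nonabelianT : ~~ abelian T) :
  gconnected (coint T) /\ diam (coint T) = 2.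
Proof.
(* The case [H = K] is included, as the walk may return to its start; one statement thus gives both
   connectedness and the upper bound. *)
have walk2 (H K : cointV T) : walk (coint T) 2 H K.
  have /andP[ntH prH] := valP H; have /andP[ntK prK] := valP K.
  have [x [Tx px nHx nKx]] := simple_prime_order_avoid simpleT prH prK.
  have VL : (<[x]>%G :!=: 1) && (<[x]>%G \proper T).
    rewrite cycle_eq1 -order_gt1 prime_gt1 //.
    exact: cycle_proper_nonabelian.
  pose L : cointV T := Sub <[x]>%G VL.
  have avoidL (M : cointV T) : x \notin val M -> coint T L M.
    move=> nMx; rewrite /coint /=; apply/andP; split.
      by apply: contraNneq nMx => <- /=; apply: cycle_id.
    (* A group of prime order meets trivially any subgroup not containing it. *)
    by apply/eqP/prime_TIg; rewrite ?cycle_subG.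
  apply/walkP; exists [:: L; K]; split=> //=.
  by rewrite coint_sym !avoidL.
have con (H K : cointV T) : connect (coint T) H K.
  have /walkP[p [_ pP <-]] := walk2 H K.
  by apply/connectP; exists p.
have [H [K [VH VK neHK ntHK]]] := simple_nonabelian_meet simpleT nonabelianT.
pose vH : cointV T := Sub H VH; pose vK : cointV T := Sub K VK.
split; first by split=> //; apply/card_gt0P; exists vH.
have nevHK : vH != vK by [].
apply/eqP; rewrite eqn_leq; apply/andP; split.
  by apply/bigmax_leqP=> x _; apply/bigmax_leqP=> y _; apply: gdist_min.
apply: leq_trans (leq_bigmax vH); apply: leq_trans (leq_bigmax vK).
have /walkP[p [<- pathp lastp]] := walk_gdist (con vH vK).
(* A shortest walk of length 0 would identify [vH] and [vK], and one of length 1 would make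
   [H :&: K] trivial. *)
case: p pathp lastp => [|L [|//]] /=.
  by move=> _ eHK; rewrite eHK eqxx in nevHK.
by rewrite andbT => /andP[_ tiHL] eLK; rewrite eLK /= (negPf ntHK) in tiHL.
Qed.
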